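(* Let $G=S_1\times\cdots\times S_m$ ($m\ge 1$) be a product of finite non-abelian pairwise isomorphic simple groups, and let $\mathcal{F}$ be an injective group cellular automaton on $G$. Then $\mathcal{F}$ is topologically transitive if and only if $\mathcal{F}$ is expansive. Furthermore, both these properties are decidable: for each of the two properties there is an algorithm that, given such a group $G$ and (the local rule of) an injective group cellular automaton $\mathcal{F}$ on $G$, decides whether $\mathcal{F}$ has the property.
   Context: For a finite group $G$, $G^{\mathbb{Z}}$ is a group under the componentwise operation, with the product topology of the discrete topologies on the factors; this topology is induced by the metric $d(c,c')=0$ if $c=c'$ and $d(c,c')=2^{-\min\{|j|:\ c_j\neq c'_j\}}$ otherwise. A group cellular automaton (GCA) on $G$ is a continuous group endomorphism $\mathcal{F}:G^{\mathbb{Z}}\to G^{\mathbb{Z}}$ commuting with the shift $\sigma$, $\sigma(c)_i=c_{i+1}$. Every GCA is given by a local rule, i.e. a homomorphism $f:G^{2\rho+1}\to G$ for some $\rho\in\mathbb{N}$ with $\mathcal{F}(c)_i=f(c_{i-\rho},\dots,c_{i+\rho})$ for all $c$ and $i$. As input to an algorithm, a GCA is represented by the (multiplication table of the) finite group $G$ and the finite table of a local rule. An injective GCA is bijective and its inverse is again a GCA. An injective GCA $\mathcal{F}$ is expansive if there is $\epsilon>0$ such that for any two distinct $c,c'\in G^{\mathbb{Z}}$ there is $n\in\mathbb{Z}$ with $d(\mathcal{F}^n(c),\mathcal{F}^n(c'))>\epsilon$. A GCA $\mathcal{F}$ is topologically transitive if for any nonempty open $U,V\subseteq G^{\mathbb{Z}}$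 there is $n\in\mathbb{N}$ with $\mathcal{F}^n(U)\cap V\ne\emptyset$. *)

(* Defs.v *)
From HB Require Import structures.
From mathcomp Require Import all_boot all_order all_algebra all_fingroup all_solvable.
From mathcomp Require Import all_classical all_reals all_analysis.

Set Implicit Arguments.
Unset Strict Implicit.
Unset Printing Implicit Defensive.

Import Order.TTheory GRing.Theory Num.Theory.

Local Open Scope classical_set_scope.
Local Open Scope ring_scope.

(** * Configurations and group cellular automata *)

(* [discrete_topology T] is convertible to [T]; [{ptws _ -> _}] carries the
   product topology. *)
Definition config (T : choiceType) := {ptws int -> discrete_topology T}.

Definition shiftc (T : choiceType) (c : config T) : config T :=
  fun i => c (i + 1).

Definition mulc (gT : finGroupType) (c c' : config gT) : config gT :=
  fun i => ((c i : gT) * (c' i : gT))%g.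

Definition gca (gT : finGroupType) (F : config gT -> config gT) : Prop :=
  [/\ continuous F,
      forall c c', F (mulc c c') = mulc (F c) (F c')
    & forall c, F (shiftc c) = shiftc (F c)].

Definition differ_at (T : choiceType) (c c' : config T) (k : nat) : bool :=
  `[< exists2 j : int, `|j|%N = k & (c j : T) != (c' j : T) >].

(* [c] and [c'] are distinct exactly when some [differ_at c c' k] holds. *)
Definition dist (R : realType) (T : choiceType) (c c' : config T) : R :=
  if pselect (exists k, differ_at c c' k) is left neq_cc'
  then 2^-1 ^+ ex_minn neq_cc' else 0.

(* The two-sided iterates are meant for bijective [F], for which
   ['pinv_id setT F] is the inverse of [F]. *)
Definition iterz (T : Type) (F : T -> T) (n : int) : T -> T :=
  match n with
  | Posz k => iter k F
  | Negz k => iter k.+1 ('pinv_id setT F)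
  end.

Definition expansive (R : realType) (gT : finGroupType)
    (F : config gT -> config gT) : Prop :=
  exists2 e : R, 0 < e &
    forall c c' : config gT, c <> c' ->
      exists n : int, e < dist R (iterz F n c) (iterz F n c').

Definition transitive_gca (gT : finGroupType) (F : config gT -> config gT) :
    Prop :=
  forall U V : set (config gT), open U -> U !=set0 -> open V -> V !=set0 ->
    exists n : nat, (iter n F @` U) `&` V !=set0.

Definition local_rule (gT : finGroupType) (rho : nat)
    (f : {ffun 'I_(2 * rho + 1) -> gT} -> gT) (F : config gT -> config gT) :
    Prop :=
  {morph f : u v / (u * v)%g} /\
  forall (c : config gT) (i : int),
    F c i = f [ffun j : 'I_(2 * rho + 1) => c (i - rho%:Z + (j : nat)%:Z) : gT].

(* The direct product is internal: the product of the [S i] is the whole of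
   [gT], which covers every group isomorphic to an external product. *)
Definition prod_isog_simple (gT : finGroupType) : Prop :=
  exists (m : nat) (S : 'I_m -> {group gT}),
    [/\ (0 < m)%N,
        \big[dprod/1%g]_(i < m) (S i : {set gT}) = [set: gT]%SET,
        forall i, simple (S i),
        forall i, ~~ abelian (S i)
      & forall i j, (S i \isog S j)%g].

(** * Algorithms: partial recursive functions *)

Inductive recf : Type :=
| RZero
| RSucc
| RProj of nat
| RComp of recf & seq recf
| RPrec of recf & recf
| RMu of recf.

(* [reval p v y]: the program [p] halts on the arguments [v] with output [y].
   Arities are not recorded in the syntax: a program lacking an argument that
   it needs has no value. *)
Inductive reval : recf -> seq nat -> nat -> Prop :=
| EvZero v : reval RZero v 0
| EvSucc x v : reval RSucc (x :: v) x.+1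
| EvProj i v : (i < size v)%N -> reval (RProj i) v (nth 0%N v i)
| EvComp p ps v w y :
    size w = size ps ->
    (forall i, (i < size ps)%N -> reval (nth RZero ps i) v (nth 0%N w i)) ->
    reval p w y -> reval (RComp p ps) v y
| EvPrec0 p q v y : reval p v y -> reval (RPrec p q) (0%N :: v) y
| EvPrecS p q n v x y :
    reval (RPrec p q) (n :: v) x -> reval q [:: n, x & v] y ->
    reval (RPrec p q) (n.+1 :: v) y
| EvMu p v n (h : nat -> nat) :
    reval p (n :: v) 0%N ->
    (forall i, (i < n)%N -> reval p (i :: v) (h i).+1) ->
    reval (RMu p) v n.

(** * Finite presentation of a group cellular automaton *)

(* Below, [s] enumerates the group without repetition, and an element is
   named by its position in [s]. *)
Definition mul_table (gT : finGroupType) (s : seq gT) : seq nat :=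
  [seq index (x * y)%g s | x <- s, y <- s].

(* The words of length [k] over [s], in lexicographic order. *)
Fixpoint words (T : Type) (s : seq T) (k : nat) : seq (seq T) :=
  if k is k'.+1 then [seq x :: w | x <- s, w <- words s k'] else [:: [::]].

Definition rule_table (gT : finGroupType) (s : seq gT) (k : nat)
    (f : {ffun 'I_k -> gT} -> gT) : seq nat :=
  [seq index (f [ffun j : 'I_k => nth 1%g w j]) s | w <- words s k].

Definition gca_input (gT : finGroupType) (s : seq gT) (rho : nat)
    (f : {ffun 'I_(2 * rho + 1) -> gT} -> gT) : seq nat :=
  [:: size s; CodeSeq.code (mul_table s);
      rho; CodeSeq.code (rule_table s f)].

(* A single program handles all groups [gT] of the class, all injective
   automata on them, all their local rules, and all numberings [s] of the
   elements of [gT]. *)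
Definition decidable_for_injective_gca
    (P : forall gT : finGroupType, (config gT -> config gT) -> Prop) : Prop :=
  exists p : recf,
    forall (gT : finGroupType) (F : config gT -> config gT) (rho : nat)
      (f : {ffun 'I_(2 * rho + 1) -> gT} -> gT) (s : seq gT),
      prod_isog_simple gT -> gca F -> injective F -> local_rule f F ->
      perm_eq s (enum gT) ->
      (P gT F -> reval p (gca_input s f) 1%N) /\
      (~ P gT F -> reval p (gca_input s f) 0%N).

(* Main.v *)
Require Import Defs.
From mathcomp Require Import all_boot all_order all_algebra all_fingroup all_solvable.
From mathcomp Require Import all_classical all_reals all_analysis.
From mathcomp Require Import zify.

(** The images under [F] of two distinct simple factors of G^Z commute, and a
    nontrivial image of a factor in a factor is everything, so [F] permutes
    the factors of G^Z, mapping a configuration supported on one site with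
    value in one simple factor to another such configuration. Since a
    configuration is determined by which of these it commutes with, the
    dynamics of [F] is that of this permutation. By the pigeonhole principle
    on values, such a configuration [delta 0 g] satisfies [F^n (delta 0 g) =
    delta l g] for some [n] with [0 < n <= |G|]. If [l != 0] for all [g],
    every factor drifts to infinity in both time directions, which gives
    transitivity and expansivity. If [l = 0], then [delta 0 g] is periodic,
    and any periodic [delta 0 g] with [g != 1] contradicts both properties.
    Hence both are equivalent to the absence of [g != 1] and [0 < n <= |G|]
    with [F^n (delta 0 g) = delta 0 g], which is checked by simulating [F] on
    finite words, encoded as numbers in base |G|. *)

Set Implicit Arguments.
Unset Strict Implicit.
Unset Printing Implicit Defensive.

Import Order.TTheory GRing.Theory Num.Theory.

(** * Closure properties of recursive functions *)

Definition recursive (k : nat) (f : seq nat -> nat) :=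
  exists p, forall v, size v = k -> reval p v (f v).

Section Recursive.
Implicit Types (k : nat) (f g h : seq nat -> nat).

Lemma eq_recursive k f g :
  (forall v, size v = k -> f v = g v) -> recursive k f -> recursive k g.
Proof. by move=> fg [p pP]; exists p => v vk; rewrite -fg//; exact: pP. Qed.

Lemma recursive_nth k i : i < k -> recursive k (nth 0 ^~ i).
Proof. by move=> ik; exists (RProj i) => v vk; constructor; rewrite vk. Qed.

Lemma recursive_comp k g (fs : seq (seq nat -> nat)) :
    recursive (size fs) g ->
    (forall i, i < size fs -> recursive k (nth (fun=> 0) fs i)) ->
  recursive k (fun v => g [seq f v | f <- fs]).
Proof.
move=> [p pP] fsP.
have [ps [sps psP]] : exists ps, size ps = size fs /\
    forall i, i < size fs -> forall v, size v = k ->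
      reval (nth RZero ps i) v (nth (fun=> 0) fs i v).
  elim: fs fsP {pP} => [_|f fs IH fsP]; first by exists [::].
  have [ps [sps psP]] := IH (fun i => fsP i.+1).
  have [q qP] := fsP 0 isT.
  by exists (q :: ps); split => [|[|i] ifs v vk]; rewrite /= ?sps//; auto.
exists (RComp p ps) => v vk.
apply: (EvComp (w := [seq f v | f <- fs])); rewrite ?size_map ?sps//.
  by move=> i ifs; rewrite (nth_map (fun=> 0))//; apply: psP.
by apply: pP; rewrite size_map.
Qed.

(** Loop bodies receive the counter (and the accumulator) in front of the arguments; this lifts the
    parameters to the longer list. *)
Lemma recursive_behead k f : recursive k f -> recursive k.+1 (f \o behead).
Proof.
move=> fP.
apply: (@eq_recursive _ (fun v =>
    f [seq h v | h <- [seq (fun v => nth 0 v i) | i <- iota 1 k]])).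
  case=> // x v [vk] /=; congr f; apply: (@eq_from_nth _ 0).
    by rewrite !size_map size_iota.
  move=> i; rewrite !size_map size_iota => ik.
  rewrite -map_comp (nth_map 0) ?size_iota//= nth_iota//.
apply: recursive_comp; rewrite size_map size_iota// => i ik.
rewrite (nth_map 0) ?size_iota// nth_iota//; apply: recursive_nth; lia.
Qed.

Lemma recursive0 k : recursive k (fun=> 0).
Proof. by exists RZero => v _; constructor. Qed.

Lemma recursive_succ k f : recursive k f -> recursive k (fun v => (f v).+1).
Proof.
move=> fP; apply: (recursive_comp (g := fun v => (nth 0 v 0).+1) (fs := [:: f])).
  by exists RSucc => -[|x []]//= _; constructor.
by case.
Qed.

Lemma recursive_const k n : recursive k (fun=> n).
Proof. by elim: n => [|n IH]; [exact: recursive0|exact: recursive_succ]. Qed.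

(** [RPrec] recurses on its first argument only, so the loop is programmed with its bound as an
    extra argument and then composed with [f]. *)
Lemma recursive_iteri k f g (h : nat -> nat -> seq nat -> nat) :
    recursive k f -> recursive k g ->
    recursive k.+2 (fun v => h (nth 0 v 0) (nth 0 v 1) (behead (behead v))) ->
  recursive k (fun v => iteri (f v) (fun i x => h i x v) (g v)).
Proof.
move=> fP [p pP] [q qP].
pose F v := iteri (nth 0 v 0) (fun i x => h i x (behead v)) (g (behead v)).
have FP : recursive k.+1 F.
  exists (RPrec p q) => -[//|n v [vk]]; rewrite /F /=.
  elim: n => [|n IH] /=; first by constructor; apply: pP.
  by apply: EvPrecS IH _; apply: qP; rewrite /= vk.
apply: (@eq_recursive _ (fun v =>
    F [seq h v | h <- f :: [seq (fun v => nth 0 v i) | i <- iota 0 k]])).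
  move=> v vk; rewrite /F /=.
  suff -> : [seq h v | h <- [seq (fun v => nth 0 v i) | i <- iota 0 k]] = v by [].
  apply: (@eq_from_nth _ 0); rewrite !size_map size_iota// => i ik.
  by rewrite -map_comp (nth_map 0) ?size_iota//= nth_iota.
apply: recursive_comp; rewrite /= size_map size_iota// => -[//|i].
rewrite ltnS => ik /=.
rewrite (nth_map 0) ?size_iota// nth_iota//; exact: recursive_nth.
Qed.

Lemma recursive_iter k f g (h : nat -> seq nat -> nat) :
    recursive k f -> recursive k g ->
    recursive k.+1 (fun v => h (nth 0 v 0) (behead v)) ->
  recursive k (fun v => iter (f v) (h ^~ v) (g v)).
Proof.
move=> fP gP /recursive_behead hP.
apply: (@eq_recursive _ (fun v => iteri (f v) (fun _ x => h x v) (g v))); last first.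
  apply: recursive_iteri => //.
  by apply: eq_recursive hP => v vk; rewrite /= nth_behead.
by move=> v _; elim: (f v) => //= n ->.
Qed.

Lemma recursive_pred k f : recursive k f -> recursive k (fun v => (f v).-1).
Proof.
move=> fP.
apply: (@eq_recursive _ (fun v =>
  iteri (f v) (fun i _ => i) 0)); last first.
  apply: (recursive_iteri (h := fun i _ _ => i)) => //.
    exact: recursive0.
  exact: recursive_nth.
by move=> v _; case: (f v).
Qed.

Lemma recursive_add k f g :
  recursive k f -> recursive k g -> recursive k (fun v => f v + g v).
Proof.
move=> fP gP; apply: (@eq_recursive _ (fun v => iter (f v) succn (g v))); last first.
  apply: (recursive_iter (h := fun x _ => x.+1)) => //.
  exact/recursive_succ/recursive_nth.
by move=> v _; rewrite iter_succn addnC.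
Qed.

Lemma recursive_sub k f g :
  recursive k f -> recursive k g -> recursive k (fun v => f v - g v).
Proof.
move=> fP gP; apply: (@eq_recursive _ (fun v => iter (g v) predn (f v))); last first.
  apply: (recursive_iter (h := fun x _ => x.-1)) => //.
  exact/recursive_pred/recursive_nth.
by move=> v _; rewrite iter_predn.
Qed.

Lemma recursive_sum k f (h : nat -> seq nat -> nat) :
    recursive k f -> recursive k.+1 (fun v => h (nth 0 v 0) (behead v)) ->
  recursive k (fun v => \sum_(i < f v) h i v).
Proof.
move=> fP hP.
apply: (@eq_recursive _ (fun v =>
  iteri (f v) (fun i x => x + h i v) 0)); last first.
  apply: (recursive_iteri (h := fun i x v => x + h i v)) => //.
    exact: recursive0.
  apply: recursive_add; first exact: recursive_nth.
  (* The body receives counter, accumulator and parameters; [fs] drops the accumulator, at position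
     1. *)
  pose fs : seq (seq nat -> nat) :=
    (fun v => nth 0 v 0) :: [seq (fun v => nth 0 v i) | i <- iota 2 k].
  apply: (@eq_recursive _ (fun v => h (nth 0 [seq f v | f <- fs] 0)
                                       (behead [seq f v | f <- fs]))).
    move=> [|x [|y v]]//= [vk]; congr h; apply: (@eq_from_nth _ 0).
      by rewrite !size_map size_iota.
    move=> i; rewrite !size_map size_iota => ik.
    by rewrite -map_comp (nth_map 0) ?size_iota//= nth_iota.
  apply: (recursive_comp (g := fun v => h (nth 0 v 0) (behead v))).
    by rewrite /= size_map size_iota.
  rewrite /= size_map size_iota => -[_|i ik] /=; first exact: recursive_nth.
  rewrite (nth_map 0) ?size_iota// nth_iota//; apply: recursive_nth; lia.
move=> v _; elim: (f v) => [|n IH]; first by rewrite big_ord0.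
by rewrite big_ord_recr /= IH.
Qed.

Lemma recursive_mul k f g :
  recursive k f -> recursive k g -> recursive k (fun v => f v * g v).
Proof.
move=> fP /recursive_behead gP.
apply: (@eq_recursive _ (fun v =>
  \sum_(i < f v) g v)); last first.
  by apply: (recursive_sum (h := fun _ v => g v)).
by move=> v _; rewrite sum_nat_const card_ord.
Qed.

Lemma recursive_exp k f g :
  recursive k f -> recursive k g -> recursive k (fun v => f v ^ g v).
Proof.
move=> /recursive_behead fP gP.
apply: (@eq_recursive _ (fun v =>
  iter (g v) (muln (f v)) 1)); last first.
  apply: (recursive_iter (h := fun x v => f v * x)) => //.
    exact: recursive_const.
  by apply: recursive_mul => //; apply: recursive_nth.
by move=> v _; rewrite iter_muln_1.
Qed.

Lemma recursive_leq k f g :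
  recursive k f -> recursive k g -> recursive k (fun v => f v <= g v).
Proof.
move=> fP gP; apply: (@eq_recursive _ (fun v => 1 - (f v - g v))); last first.
  apply: recursive_sub; first exact: recursive_const.
  exact: recursive_sub.
by move=> v _; case: leqP; lia.
Qed.

Lemma recursive_eqn k f g :
  recursive k f -> recursive k g -> recursive k (fun v => f v == g v).
Proof.
move=> fP gP.
apply: (@eq_recursive _ (fun v =>
  (f v <= g v) * (g v <= f v))); last first.
  by apply: recursive_mul; apply: recursive_leq.
by move=> v _; rewrite mulnb -eqn_leq.
Qed.

Lemma recursive_neqn k f g :
  recursive k f -> recursive k g -> recursive k (fun v => f v != g v).
Proof.
move=> fP gP; apply: (@eq_recursive _ (fun v => 1 - (f v == g v))); last first.
  apply: recursive_sub; first exact: recursive_const.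
  exact: recursive_eqn.
by move=> v _; case: eqVneq.
Qed.

Lemma sum_ltn k n : \sum_(i < k) (i < n) = minn k n.
Proof.
elim: k => [|k IH]; first by rewrite big_ord0 min0n.
by rewrite big_ord_recr /= IH; lia.
Qed.

(** The quotient counts the positive multiples of [d] up to [m], of which there are at most [m]. *)
Lemma divn_sum m d : 0 < d -> m %/ d = \sum_(i < m) (i.+1 * d <= m).
Proof.
move=> d0; under eq_bigr do rewrite -leq_divRL//.
by rewrite sum_ltn; apply/esym/minn_idPr/leq_div.
Qed.

Lemma recursive_div k f g :
  recursive k f -> recursive k g -> recursive k (fun v => f v %/ g v).
Proof.
move=> fP gP.
(* The factor [0 < g v] enforces that division by 0 gives 0, where the sum alone would give
   [f v]. *)
apply: (@eq_recursive _ (fun v =>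
  (0 < g v) * \sum_(i < f v) (i.+1 * g v <= f v))); last first.
  apply: recursive_mul.
    by apply: recursive_leq => //; apply: recursive_const.
  apply: (recursive_sum (h := fun i v => i.+1 * g v <= f v)) => //.
  apply: recursive_leq; last exact: recursive_behead fP.
  apply: recursive_mul; last exact: recursive_behead gP.
  exact/recursive_succ/recursive_nth.
move=> v _; case: (posnP (g v)) => [->|g0]; first by rewrite divn0.
by rewrite mul1n divn_sum.
Qed.

Lemma recursive_mod k f g :
  recursive k f -> recursive k g -> recursive k (fun v => f v %% g v).
Proof.
move=> fP gP; apply: (@eq_recursive _ (fun v => f v - f v %/ g v * g v)); last first.
  apply: recursive_sub => //; apply: recursive_mul => //.
  exact: recursive_div.
by move=> v _; rewrite {1}(divn_eq (f v) (g v)) addnC addnK.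
Qed.

End Recursive.

Ltac recursive_step :=
  lazymatch goal with
  | |- recursive _ (fun v => _ + _) => apply: recursive_add
  | |- recursive _ (fun v => _ - _) => apply: recursive_sub
  | |- recursive _ (fun v => _ * _) => apply: recursive_mul
  | |- recursive _ (fun v => _ ^ _) => apply: recursive_exp
  | |- recursive _ (fun v => _ %/ _) => apply: recursive_div
  | |- recursive _ (fun v => _ %% _) => apply: recursive_mod
  | |- recursive _ (fun v => nat_of_bool (_ != _)) => apply: recursive_neqn
  | |- recursive _ (fun v => nat_of_bool (_ == _)) => apply: recursive_eqn
  | |- recursive _ (fun v => _.+1) => apply: recursive_succ
  | |- recursive _ (fun v => nth 0 v _) => exact: recursive_nth
  | |- _ => first [exact: recursive_const | assumption |
      match goal with H : recursive _ _ |- _ => exact: (recursive_behead H) end]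
  end.

Ltac solve_recursive := repeat recursive_step.

(* [CodeSeq.code (x :: s)] is [2 ^ x * (CodeSeq.code s).*2.+1]. *)
Definition code_head c := \sum_(i < c) (c %% 2 ^ i.+1 == 0).
Definition code_tail c := c %/ 2 ^ code_head c %/ 2.
Definition code_nth c n := code_head (iter n code_tail c).

(** [code_head] counts the powers [2 ^ i.+1] dividing [c], so it is the 2-adic valuation; the bound
    [i < c] loses none since [n < 2 ^ n]. *)
Lemma code_headE n m : code_head (2 ^ n * m.*2.+1) = n.
Proof.
have m0 : 0 < m.*2.+1 by [].
rewrite /code_head.
have -> : \sum_(i < 2 ^ n * m.*2.+1) (2 ^ n * m.*2.+1 %% 2 ^ i.+1 == 0) =
    \sum_(i < 2 ^ n * m.*2.+1) (i < n).
  apply: eq_bigr => i _; congr nat_of_bool; rewrite -[LHS]/(2 ^ i.+1 %| _).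
  rewrite Gauss_dvdl; first by rewrite dvdn_Pexp2l.
  by rewrite coprimeXl// coprime2n /= odd_double.
rewrite sum_ltn; apply/minn_idPr.
by rewrite (leq_trans (ltnW (ltn_expl n (ltnSn 1))))// leq_pmulr.
Qed.

Lemma code_tailE n m : code_tail (2 ^ n * m.*2.+1) = m.
Proof.
rewrite /code_tail code_headE mulKn ?expn_gt0// divn2.
by rewrite /= uphalf_double.
Qed.

Lemma code_nthE s n : code_nth (CodeSeq.code s) n = nth 0 s n.
Proof.
elim: s n => [|x s IH] [|n]; rewrite /code_nth /=.
- by rewrite /code_head big_ord0.
(* Past the end the code is 0, which [code_tail] fixes, so decoding yields 0, the default value of
   [nth]. *)
- have tail0 : code_tail 0 = 0 by rewrite /code_tail !div0n.
  have -> : code_tail (iter n code_tail 0) = 0 by elim: n => //= n ->.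
  by rewrite /code_head big_ord0.
- exact: code_headE.
- by rewrite -iterS iterSr code_tailE; exact: IH.
Qed.

(** * The decision function and its computability *)

Section DecisionFunction.
Implicit Types q e r rho g p : nat.

(* The identity is the only idempotent of a group. *)
Definition idempotent_index q mt := \sum_(i < q) i * (code_nth mt (i * q + i) == i).

(** Base-[q] code of a window of [delta 0 g]: [e] is the index of the identity, [p] the digit of
    site 0, [M] the length. *)
Definition single_digit q e g p M :=
  \sum_(i < M) q ^ i * ((i == p :> nat) * g + (i != p :> nat) * e).

(* A word is encoded in base [q] with its last letter as the digit of lowest
   weight, so that the code of a word of length [r] is its lexicographic rank,
   i.e. its position in the rule table. *)
Definition block_map q r rt M X :=
  \sum_(i < M) q ^ i * code_nth rt (X %/ q ^ i %% q ^ r).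

(* Digits are not recentred: at time [t] the digit [i] stands for the site
   [2 * rho * n - rho * t - i], and the word loses [2 * rho] digits per step. *)
Definition evolve q rho rt n X :=
  iteri n
    (fun t => block_map q (2 * rho + 1) rt (4 * rho * n + 1 - 2 * rho * t.+1)) X.

(** The pairs counted are a period [n.+1] and a nontrivial periodic letter [g]. The initial window
    has radius [2 * rho * n.+1], so that radius [rho * n.+1], enough for the support of the image,
    remains at the end. *)
Definition count_periodic q mt rho rt :=
  \sum_(n < q) \sum_(g < q)
    (g != idempotent_index q mt :> nat) *
    (evolve q rho rt n.+1 (single_digit q (idempotent_index q mt) g
       (2 * rho * n.+1) (4 * rho * n.+1 + 1)) ==
     single_digit q (idempotent_index q mt) g
       (rho * n.+1) (2 * rho * n.+1 + 1)).

Section Recursive.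
Variable k : nat.
Implicit Types f : seq nat -> nat.

Lemma recursive_code_head f :
  recursive k f -> recursive k (fun v => code_head (f v)).
Proof.
move=> fP; apply: (recursive_sum (h := fun i v => f v %% 2 ^ i.+1 == 0)) => //.
solve_recursive.
Qed.

Lemma recursive_code_tail f :
  recursive k f -> recursive k (fun v => code_tail (f v)).
Proof.
move=> fP; have := recursive_code_head fP.
by rewrite /code_tail => ?; solve_recursive.
Qed.
End Recursive.

Lemma recursive_code_nth k f f' :
  recursive k f -> recursive k f' -> recursive k (fun v => code_nth (f v) (f' v)).
Proof.
move=> fP f'P; apply: recursive_code_head.
apply: (recursive_iter (h := fun x _ => code_tail x)) => //.
by apply: recursive_code_tail; solve_recursive.
Qed.

Lemma recursive_idempotent_index k fq fmt :
  recursive k fq -> recursive k fmt ->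
  recursive k (fun v => idempotent_index (fq v) (fmt v)).
Proof.
move=> qP mtP.
apply: (recursive_sum
  (h := fun i v => i * (code_nth (fmt v) (i * fq v + i) == i))) => //.
solve_recursive; apply: recursive_code_nth; solve_recursive.
Qed.

Lemma recursive_single_digit k fq fe fg fp fM :
  recursive k fq -> recursive k fe -> recursive k fg -> recursive k fp ->
  recursive k fM ->
  recursive k (fun v => single_digit (fq v) (fe v) (fg v) (fp v) (fM v)).
Proof.
move=> qP eP gP pP MP.
apply: (recursive_sum (h := fun i v =>
  fq v ^ i * ((i == fp v) * fg v + (i != fp v) * fe v))) => //.
solve_recursive.
Qed.

Lemma recursive_block_map k fq fr frt fM fX :
  recursive k fq -> recursive k fr -> recursive k frt -> recursive k fM ->
  recursive k fX ->
  recursive k (fun v => block_map (fq v) (fr v) (frt v) (fM v) (fX v)).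
Proof.
move=> qP rP rtP MP XP.
apply: (recursive_sum (h := fun i v =>
  fq v ^ i * code_nth (frt v) (fX v %/ fq v ^ i %% fq v ^ fr v))) => //.
solve_recursive; apply: recursive_code_nth; solve_recursive.
Qed.

Lemma recursive_evolve k fq frho frt fn fX :
  recursive k fq -> recursive k frho -> recursive k frt -> recursive k fn ->
  recursive k fX ->
  recursive k (fun v => evolve (fq v) (frho v) (frt v) (fn v) (fX v)).
Proof.
move=> qP rP rtP nP XP.
apply: (recursive_iteri (h := fun t X v => block_map (fq v) (2 * frho v + 1)
  (frt v) (4 * frho v * fn v + 1 - 2 * frho v * t.+1) X)) => //.
move: qP rP rtP nP; do 4 move=> /recursive_behead/recursive_behead ?.
by apply: recursive_block_map; solve_recursive.
Qed.

Lemma recursive_count_periodic k fq fmt frho frt :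
  recursive k fq -> recursive k fmt -> recursive k frho -> recursive k frt ->
  recursive k (fun v => count_periodic (fq v) (fmt v) (frho v) (frt v)).
Proof.
move=> qP mtP rhoP rtP.
pose e v := idempotent_index (fq v) (fmt v).
pose body g n v := (g != e v) *
  (evolve (fq v) (frho v) (frt v) n.+1 (single_digit (fq v) (e v) g
       (2 * frho v * n.+1) (4 * frho v * n.+1 + 1)) ==
     single_digit (fq v) (e v) g (frho v * n.+1) (2 * frho v * n.+1 + 1)).
apply: (recursive_sum (h := fun n v => \sum_(g < fq v) body g n v)) => //.
apply: (recursive_sum (h := fun g v => body g (nth 0 v 0) (behead v))).
  solve_recursive.
have := recursive_idempotent_index qP mtP.
move: qP mtP rhoP rtP; rewrite /body -/e.
do 5 move=> /recursive_behead/recursive_behead ?.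
have ? : recursive k.+2 (fun v => nth 0 (behead v) 0).
  by apply: (eq_recursive _ (recursive_nth (i := 1) _)) => // -[].
apply: recursive_mul; first solve_recursive.
apply: recursive_eqn.
  apply: recursive_evolve; solve_recursive.
  by apply: recursive_single_digit; solve_recursive.
by apply: recursive_single_digit; solve_recursive.
Qed.

End DecisionFunction.

(** * Simulating the automaton on words *)

Lemma ltn_digits q (b : nat -> nat) M : (forall i, i < M -> b i < q) ->
  \sum_(j < M) q ^ j * b j < q ^ M.
Proof.
elim: M => [|M IH] bq; first by rewrite big_ord0 expn0.
rewrite big_ord_recr /= expnS.
have := IH (fun i iM => bq i (ltnW iM)).
have := bq M (ltnSn M); move: (b M) (\sum_(_ < _) _) (q ^ M) => x y z; nia.
Qed.

(** Division by [q ^ i] deletes the [i] lowest digits, and reduction modulo [q ^ r] keeps the next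
    [r]. *)
Lemma digits_window q (b : nat -> nat) M i r :
    (forall j, j < M -> b j < q) -> i + r <= M ->
  (\sum_(j < M) q ^ j * b j) %/ q ^ i %% q ^ r = \sum_(j < r) q ^ j * b (i + j).
Proof.
move=> bq irM; case: (posnP r) => [->|r0]; first by rewrite expn0 modn1 big_ord0.
have q0 : 0 < q by apply: leq_ltn_trans (bq i _) => //; lia.
have split_sum k l (c : nat -> nat) :
    \sum_(j < k + l) q ^ j * c j =
    \sum_(j < k) q ^ j * c j + q ^ k * \sum_(j < l) q ^ j * c (k + j).
  rewrite big_split_ord /=; congr addn; rewrite big_distrr /=.
  by apply: eq_bigr => j _; rewrite expnD mulnA.
have -> : M = i + (r + (M - (i + r))) by lia.
rewrite split_sum addnC mulnC divnMDl ?expn_gt0 ?q0//.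
rewrite [X in _ + X]divn_small ?addn0; last first.
  by apply: ltn_digits => j ji; apply: bq; lia.
rewrite (split_sum _ _ (fun j => b (i + j))) addnC mulnC modnMDl modn_small//.
by apply: (@ltn_digits _ (fun j => b (i + j))) => j jr; apply: bq; lia.
Qed.

Lemma digits_inj q M (b b' : nat -> nat) :
    (forall j, j < M -> b j < q) -> (forall j, j < M -> b' j < q) ->
    \sum_(j < M) q ^ j * b j = \sum_(j < M) q ^ j * b' j ->
  forall i, i < M -> b i = b' i.
Proof.
move=> bq b'q E i iM.
have := digits_window bq (_ : i + 1 <= M); rewrite E digits_window// ?addn1//.
by rewrite !big_ord1 !expn0 !mul1n !addn0 => ->.
Qed.

Lemma nth_allpairs (T1 T2 T3 : Type) (f : T1 -> T2 -> T3) x1 x2 x3 s t i j :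
    i < size s -> j < size t ->
  nth x3 [seq f x y | x <- s, y <- t] (i * size t + j) =
  f (nth x1 s i) (nth x2 t j).
Proof.
elim: s i => // x s IH [|i] /= si tj; rewrite nth_cat size_map.
  by rewrite mul0n add0n tj (nth_map x2).
by rewrite mulSn -addnA ltnNge leq_addr/= addKn IH.
Qed.

Section Tables.
Variables (gT : finGroupType) (s : seq gT).
Hypothesis sP : perm_eq s (enum gT).
Local Notation q := (size s).
Local Notation idx x := (index x s).

Let mem_s x : x \in s. Proof. by rewrite (perm_mem sP) mem_enum. Qed.

Lemma ltn_index x : idx x < q. Proof. by rewrite index_mem. Qed.

Lemma index_enum_inj : injective (fun x => idx x).
Proof. by move=> x y E; rewrite -(nth_index 1%g (mem_s x)) E nth_index. Qed.

Lemma nth_mul_table x y : nth 0 (mul_table s) (idx x * q + idx y) = idx (x * y)%g.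
Proof. by rewrite (nth_allpairs _ 1%g 1%g) ?ltn_index// !nth_index. Qed.

Lemma size_words k : size (words s k) = q ^ k.
Proof. by elim: k => //= k IH; rewrite size_allpairs IH expnS. Qed.

(** In lexicographic order the last letter varies fastest and is the digit of weight 1, hence the
    reversal. *)
Lemma nth_words k (b : nat -> gT) :
  nth [::] (words s k) (\sum_(j < k) q ^ j * idx (b j)) = rev (mkseq b k).
Proof.
elim: k => [|k IH]; first by rewrite big_ord0.
rewrite big_ord_recr /= addnC mulnC -size_words.
rewrite (nth_allpairs _ 1%g [::]) ?ltn_index//.
  by rewrite nth_index// IH -rev_rcons mkseqS.
rewrite size_words.
by apply: (@ltn_digits _ (fun j => idx (b j))) => i _; exact: ltn_index.
Qed.

Lemma nth_rule_table k (f : {ffun 'I_k -> gT} -> gT) (b : nat -> gT) :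
  nth 0 (rule_table s f) (\sum_(j < k) q ^ j * idx (b j)) =
  idx (f [ffun j : 'I_k => b (k - j.+1)]).
Proof.
rewrite (nth_map [::]); last first.
  rewrite size_words.
  by apply: (@ltn_digits _ (fun j => idx (b j))) => i _; exact: ltn_index.
rewrite nth_words; congr (index (f _) s); apply/ffunP => j; rewrite !ffunE.
by rewrite nth_rev size_mkseq// nth_mkseq//; have := ltn_ord j; lia.
Qed.

Lemma idempotent_indexE :
  idempotent_index q (CodeSeq.code (mul_table s)) = idx (1%g : gT).
Proof.
rewrite /idempotent_index (bigD1 (Ordinal (ltn_index 1%g)))//=.
rewrite code_nthE nth_mul_table mulg1 eqxx muln1 big1 ?addn0// => i i1.
have [x ix] : exists x, idx x = i.
  exists (nth 1%g s i); rewrite index_uniq//.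
  by rewrite (perm_uniq sP) enum_uniq.
rewrite code_nthE -ix nth_mul_table; case: eqP; rewrite ?muln0// => /index_enum_inj.
move=> /eqP; rewrite eq_mulgV1 mulgK => /eqP x1.
by case/eqP: i1; apply: val_inj; rewrite /= -ix x1.
Qed.

End Tables.

Section Simulation.
Variables (gT : finGroupType) (F : config gT -> config gT) (rho : nat).
Variable (f : {ffun 'I_(2 * rho + 1) -> gT} -> gT).
Hypothesis fF : local_rule f F.
Variable s : seq gT.
Hypothesis sP : perm_eq s (enum gT).
Local Notation q := (size s).
Local Notation idx x := (index (x : gT) s).

(** Output digit [i] reads the input digits [i] to [i + 2 * rho], that is the sites from
    [a - i - 2 * rho] to [a - i], centred at [a - rho - i]. *)
Lemma block_mapE (c : config gT) (a : int) M :
  block_map q (2 * rho + 1) (CodeSeq.code (rule_table s f)) M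
    (\sum_(i < M + 2 * rho) q ^ i * idx (c (a - i%:Z)%R)) =
  \sum_(i < M) q ^ i * idx (F c (a - rho%:Z - i%:Z)%R).
Proof.
apply: eq_bigr => i _; rewrite code_nthE.
rewrite (@digits_window _ (fun j => idx (c (a - j%:Z)%R))); first last.
- by have := ltn_ord i; lia.
- by move=> j _; exact: ltn_index.
rewrite (nth_rule_table sP f (fun j => c (a - (i + j)%N%:Z)%R)).
rewrite fF.2; congr (_ * index (f _) _); apply/ffunP => j; rewrite !ffunE.
by congr (c _); have := ltn_ord j; lia.
Qed.

Lemma evolveE n (c : config gT) :
  evolve q rho (CodeSeq.code (rule_table s f)) n
    (\sum_(i < 4 * rho * n + 1) q ^ i * idx (c ((2 * rho * n)%N%:Z - i%:Z)%R)) =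
  \sum_(i < 2 * rho * n + 1) q ^ i * idx (iter n F c ((rho * n)%N%:Z - i%:Z)%R).
Proof.
(* The window sizes depend on the total time [n], so the induction runs over a separate step count
   [t]. *)
have main t : t <= n -> iteri t (fun t => block_map q (2 * rho + 1)
      (CodeSeq.code (rule_table s f)) (4 * rho * n + 1 - 2 * rho * t.+1))
    (\sum_(i < 4 * rho * n + 1) q ^ i * idx (c ((2 * rho * n)%N%:Z - i%:Z)%R)) =
   \sum_(i < 4 * rho * n + 1 - 2 * rho * t)
     q ^ i * idx (iter t F c ((2 * rho * n)%N%:Z - (rho * t)%N%:Z - i%:Z)%R).
  elim: t => [_|t IH tn].
    rewrite /= muln0 subn0; apply: eq_bigr => i _; congr (_ * index (c _) _).
    lia.
  rewrite [LHS]/= IH ?(ltnW tn)//.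
  have -> : 4 * rho * n + 1 - 2 * rho * t =
            4 * rho * n + 1 - 2 * rho * t.+1 + 2 * rho by nia.
  rewrite block_mapE; apply: eq_bigr => i _; congr (_ * index (F _ _) _).
  by nia.
rewrite /evolve main//.
have -> : 4 * rho * n + 1 - 2 * rho * n = 2 * rho * n + 1 by nia.
by apply: eq_bigr => i _; congr (_ * index (iter n F c _) _); nia.
Qed.

End Simulation.

(** * Deciding the existence of periodic one-site configurations *)

Definition delta (gT : finGroupType) (k : int) (g : gT) : config gT :=
  fun i => if i == k then g else 1%g.

(** Bounding the period by the order of the group makes the search finite; the bound is the one on
    return times in [delta_recurrent]. *)
Definition has_periodic_delta (gT : finGroupType) (F : config gT -> config gT) :=
  exists g n, [/\ g != 1%g, 0 < n <= #|gT| & iter n F (delta 0%R g) = delta 0%R g].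

Section Decision.
Variables (gT : finGroupType) (F : config gT -> config gT) (rho : nat).
Variable (f : {ffun 'I_(2 * rho + 1) -> gT} -> gT).
Hypothesis fF : local_rule f F.
Variable s : seq gT.
Hypothesis sP : perm_eq s (enum gT).
Local Notation q := (size s).
Local Notation idx x := (index (x : gT) s).

(** Values travel at most [rho] sites per step, and the local rule maps the identity word to the
    identity. *)
Lemma iter_delta_support n g i : rho * n < `|i|%N -> iter n F (delta 0%R g) i = 1%g.
Proof.
elim: n i => [|n IH] i; first by rewrite muln0 /delta /= => i0; case: eqP => //; lia.
move=> ni; rewrite /= fF.2.
have -> : [ffun j : 'I_(2 * rho + 1) =>
    iter n F (delta 0%R g) (i - rho%:Z + (j : nat)%:Z)%R : gT] = [ffun=> 1%g].
  by apply/ffunP => j; rewrite !ffunE IH//; have := ltn_ord j; lia.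
by apply: (mulgI (f [ffun=> 1%g])); rewrite -fF.1 !mulg1.
Qed.

Lemma single_digitE g p M :
  single_digit q (idx 1%g) (idx g) p M =
  \sum_(i < M) q ^ i * idx (delta 0%R g (p%:Z - i%:Z)%R).
Proof.
apply: eq_bigr => i _; congr (_ * _); rewrite /delta.
have -> : ((p%:Z - i%:Z)%R == 0%R) = (i == p :> nat) by lia.
by case: eqP; rewrite /= !(mul0n, mul1n, addn0).
Qed.

(** Outside radius [rho * n] both configurations are trivial; inside, equal codes have equal digits,
    hence equal letters. *)
Lemma iter_deltaP n g :
  reflect (iter n F (delta 0%R g) = delta 0%R g)
    (evolve q rho (CodeSeq.code (rule_table s f)) n
       (single_digit q (idx 1%g) (idx g) (2 * rho * n) (4 * rho * n + 1)) ==
     single_digit q (idx 1%g) (idx g) (rho * n) (2 * rho * n + 1)).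
Proof.
rewrite !single_digitE (evolveE fF sP); apply: (iffP eqP) => [E|->//].
apply/funext => i; have [ni|ni] := ltnP (rho * n) `|i|%N.
  by rewrite iter_delta_support// /delta; case: eqP => //; lia.
pose b (c : config gT) j := idx (c ((rho * n)%N%:Z - j%:Z)%R).
have bq c j : j < 2 * rho * n + 1 -> b c j < q by move=> _; exact: ltn_index.
have := @digits_inj q _ (b _) (b _) (bq _) (bq _) E `|((rho * n)%N%:Z - i)%R|%N.
rewrite /b.
have -> : ((rho * n)%N%:Z - (`|((rho * n)%N%:Z - i)%R|%N)%:Z = i)%R by lia.
by move=> /(_ _)/(index_enum_inj sP); apply; lia.
Qed.

Lemma count_periodicP :
  reflect (~ has_periodic_delta F)
    (count_periodic q (CodeSeq.code (mul_table s)) rho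
       (CodeSeq.code (rule_table s f)) == 0).
Proof.
rewrite /count_periodic (idempotent_indexE sP).
have qE : q = #|gT| by rewrite (perm_size sP) cardE.
apply: (iffP eqP) => [E [g [n [g1 /andP[n0 nq] /iter_deltaP gn]]]|noper].
  case: n n0 nq gn E => // n _; rewrite -qE => nq gn.
  rewrite (bigD1 (Ordinal nq))//=.
  rewrite (bigD1 (Ordinal (ltn_index sP g)))//= gn.
  have -> // : idx g != idx 1%g.
  by apply: contra g1 => /eqP/(index_enum_inj sP)->.
rewrite big1// => n _; rewrite big1// => i _.
have gi : idx (nth 1%g s i) = i by rewrite index_uniq// (perm_uniq sP) enum_uniq.
rewrite -[X in X != _]gi -[X in single_digit _ _ X]gi.
case: iter_deltaP; rewrite ?muln0// => per; case: eqP => // g1.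
case: noper; exists (nth 1%g s i), n.+1; split => //.
  by apply/eqP => E; rewrite E in g1.
by rewrite -qE ltn_ord.
Qed.

End Decision.

(** The program tests whether [count_periodic] vanishes on the four entries of [gca_input]; it will
    serve both properties. *)
Lemma decidable_periodic_delta
    (P : forall gT : finGroupType, (config gT -> config gT) -> Prop) :
    (forall gT F, prod_isog_simple gT -> gca F -> injective F ->
      P gT F <-> ~ has_periodic_delta F) ->
  decidable_for_injective_gca P.
Proof.
move=> PE.
have [p pP] : recursive 4 (fun v => count_periodic (nth 0 v 0) (nth 0 v 1)
    (nth 0 v 2) (nth 0 v 3) == 0).
  apply: recursive_eqn; last exact: recursive_const.
  by apply: recursive_count_periodic; exact: recursive_nth.
exists p => gT F rho f s sG Fgca Finj fF sP.
have := pP (gca_input s f) erefl; rewrite /gca_input /=.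
have [noper|per] := count_periodicP fF sP; have {}PE := PE _ _ sG Fgca Finj.
  by split=> // /PE.
by split => // /PE.
Qed.

(** * Topology and metric on configurations *)

Section ConfigTopology.
Variable T : choiceType.
Implicit Types (c u : config T) (w : nat).
Local Open Scope classical_set_scope.

Definition cylinder u w : set (config T) :=
  [set c : config T | forall i : int, `|i|%N <= w -> c i = u i].

(** The filter generated by the cylinders around [u] converges to [u] in each coordinate, hence in
    the product topology. *)
Lemma nbhs_cylinder u (O : set (config T)) : open O -> O u ->
  exists w, cylinder u w `<=` O.
Proof.
move=> oO Ou; pose B := filter_from [set: nat] (cylinder u).
have BF : Filter B.
  apply: filter_from_filter; first by exists 0.
  move=> v w _ _; exists (maxn v w) => // c cP; split=> i iw; apply: cP; lia.
suff /(_ O) : B --> (u : config T).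
  by move=> /(_ (open_nbhs_nbhs (conj oO Ou)))[w _ wO]; exists w.
apply/cvg_sup => i Q [A [[W oW <-] Wu] sAQ].
exists `|i|%N => // c cP; apply: sAQ => /=.
by have /= -> := cP i (leqnn _).
Qed.

Lemma open_site (i : int) (A : set T) : open [set c : config T | A (c i)].
Proof.
pose K (_ : int) := discrete_topology T.
apply: (@open_comp (prod_topology K) (K i) (proj i) A).
  by move=> + _; exact: (@proj_continuous _ K i).
exact: discrete_open.
Qed.

End ConfigTopology.

Section Dist.
Variables (R : realType) (T : choiceType).
Implicit Types c : config T.
Local Open Scope ring_scope.

Lemma dist_ge c c' (i : int) : c i <> c' i -> 2^-1 ^+ `|i|%N <= dist R c c'.
Proof.
move=> ci.
have di : differ_at c c' `|i|%N by apply/asboolP; exists i => //; apply/eqP.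
rewrite /dist; case: pselect => [ex|[]]; last by exists `|i|%N.
case: ex_minnP => m _ /(_ _ di) mi.
by apply: ler_wiXn2l => //; rewrite ?invr_ge0 ?ler0n// invf_le1 ?ltr0n// ler1n.
Qed.

Lemma dist_le c c' w : (forall i : int, (`|i| < w)%N -> c i = c' i) ->
  dist R c c' <= 2^-1 ^+ w.
Proof.
move=> cw; rewrite /dist; case: pselect => [ex|_]; last first.
  by rewrite exprn_ge0// invr_ge0 ler0n.
case: ex_minnP => m /asboolP[j <- cj] _.
apply: ler_wiXn2l; rewrite ?invr_ge0 ?ler0n// ?invf_le1 ?ltr0n// ?ler1n//.
by rewrite leqNgt; apply: contra cj => /cw ->.
Qed.

End Dist.

(** * Products of isomorphic nonabelian simple groups *)

Section ProductOfSimpleGroups.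
Local Open Scope group_scope.
Variables (gT : finGroupType) (m : nat) (S : 'I_m -> {group gT}).
Hypothesis defG : \big[dprod/1]_(i < m) (S i : {set gT}) = [set: gT]%SET.
Hypothesis simS : forall i, simple (S i).
Hypothesis nabS : forall i, ~~ abelian (S i).
Hypothesis isoS : forall i j, S i \isog S j.

Lemma factor_dprod i : exists2 H : {group gT}, S i \x H = [set: gT]%SET &
  forall j, j != i -> S j \subset H.
Proof.
have := defG; rewrite (bigD1 i)//= => /[dup] defSH /dprodP[[K H _ defH] _ _ _].
exists H => [|j ji]; first by rewrite -defH.
move: defH; rewrite (bigD1 j)//= => /[dup] /dprodP[[K1 K2 _ ->] _ _ _] /dprodW <-.
exact: mulG_subl.
Qed.

Lemma factors_commute i j x : j != i -> x \in S j -> x \in 'C(S i).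
Proof.
have [H /dprodP[_ _ cSH _] sH] := factor_dprod i.
by move=> /sH /fintype.subsetP sSH /sSH; apply/fintype.subsetP.
Qed.

(** This is the projection onto [S i], stated modulo ['C(S i)], which contains the other factors. *)
Lemma factor_component i x : exists2 y, y \in S i & y^-1 * x \in 'C(S i).
Proof.
have [H /dprodP[_ defSH cSH _] _] := factor_dprod i.
have : x \in S i * H by rewrite defSH inE.
case/mulsgP => y z yS zH ->; exists y => //.
by rewrite mulKg (fintype.subsetP cSH).
Qed.

Lemma center_factor i : 'Z(S i) = 1.
Proof.
have [_ /(_ 'Z(S i)%G)[]//] := simpleP _ (simS i); first exact: center_normal.
by move=> Z; case/negP: (nabS i); apply/center_idP.
Qed.

Lemma factor_cent_eq1 i x : x \in S i -> x \in 'C(S i) -> x = 1.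
Proof. by move=> xS xC; apply/set1gP; rewrite -(center_factor i) inE xS. Qed.

(** Such an element centralizes the group generated by the factors, and the centre of a direct
    product is the product of the centres, here all trivial. *)
Lemma all_cent_eq1 x : (forall i, x \in 'C(S i)) -> x = 1.
Proof.
move=> xC; apply/set1gP.
have := center_bigdprod defG.
rewrite big1 => [Z|i _]; last exact: center_factor.
rewrite Z.
rewrite inE finset.in_setT /= -(bigdprodWY defG) cent_gen.
apply/centP => y /bigcupP[i _ yS]; exact: (centP (xC i)).
Qed.

Lemma center_trivial (x : gT) : (forall y, commute x y) -> x = 1.
Proof. by move=> xy; apply: all_cent_eq1 => i; apply/centP => y _; exact: xy. Qed.

(** The product of the [x i] works, because the other factors centralize [S i]. *)
Lemma glue_components (x : 'I_m -> gT) : (forall i, x i \in S i) ->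
  exists y, forall i, (x i)^-1 * y \in 'C(S i).
Proof.
move=> xS; exists (\prod_(i <- enum 'I_m) x i) => i.
have : uniq (enum 'I_m) by exact: enum_uniq.
have : i \in enum 'I_m by rewrite mem_enum.
elim: (enum 'I_m) => // j r IH + /andP[jr ur].
rewrite big_cons inE; have [ij _|ij /= ir] := eqVneq i j.
  rewrite -ij mulKg big_seq; apply: group_prod => k kr.
  apply: (factors_commute _ (xS k)); apply/eqP => ki.
  by case/negP: jr; rewrite -ij -ki.
have xjC : x j \in 'C(S i) by apply: (factors_commute _ (xS j)); rewrite eq_sym.
rewrite mulgA -(centP xjC) ?groupV// -mulgA.
by rewrite groupM// IH.
Qed.

Lemma morph_factor_onto i j (phi : gT -> gT) x0 :
    {in S i &, {morph phi : x y / x * y}} -> x0 \in S i -> phi x0 \notin 'C(S j) ->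
  forall y, y \in S j -> exists2 x, x \in S i & y^-1 * phi x \in 'C(S j).
Proof.
move=> phiM x0S phix0 y yS.
(* The image of [S i] is simple and not contained in ['C(S j)], hence meets it
   trivially; as it has the order of [S j], it is a complement of ['C(S j)]. *)
pose f := Morphism phiM.
have kerf : 'ker f = 1.
  have [_ /(_ ('ker f)%G)[]//] := simpleP _ (simS i); first exact: ker_normal.
  move=> kerS; case/negP: phix0.
  have : x0 \in 'ker f by rewrite kerS.
  by move/mker => /= ->; exact: group1.
have injf : 'injm f by rewrite kerf.
have simK : simple (f @* S i).
  by rewrite -(isog_simple (sub_isog (subxx _) injf)).
have [H /[dup] defSH /dprodP[_ defSHm cSH _] _] := factor_dprod j.
(* The component in [S j] of an element of ['C(S j)] is central in [S j], hence trivial. *)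
have defH : 'C(S j) = H.
  apply/eqP; rewrite finset.eqEsubset cSH andbT; apply/fintype.subsetP => z zC.
  have : z \in S j * H by rewrite defSHm inE.
  case/mulsgP => u v uS vH zE.
  suff -> : z = v by [].
  rewrite zE (@factor_cent_eq1 j u) ?mul1g//.
  by rewrite -(mulgK v u) -zE groupM// groupV (fintype.subsetP cSH).
have nC : normal H [set: gT]%SET by case/dprod_normal2: defSH.
have tiKC : f @* S i :&: H = 1.
  have [_ /(_ (f @* S i :&: H)%G)[]//] := simpleP _ simK.
    by apply: normalGI nC; rewrite finset.subsetT.
  move=> KH; case/negP: phix0; rewrite defH.
  have : phi x0 \in f @* S i :&: H by rewrite KH; exact: mem_morphim.
  by case/finset.setIP.
have KCG : f @* S i * H = [set: gT]%SET.
  apply/eqP; rewrite eqEcard finset.subsetT /= -(dprod_card defSH).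
  by rewrite TI_cardMg// card_injm// (card_isog (isoS i j)).
have : y \in f @* S i * H by rewrite KCG inE.
case/mulsgP => _ v /morphimP[x _ xS ->] vH yE; exists x => //.
by rewrite defH yE invMg -mulgA mulVg mulg1 groupV.
Qed.

End ProductOfSimpleGroups.

(** * The automaton permutes the factors *)

Section ConfigGroup.
Variable gT : finGroupType.
Implicit Types (c d : config gT) (g : gT) (k l i : int).

Definition onec : config gT := fun=> 1%g.

Definition shiftz (n : int) c : config gT := fun i => c (i + n)%R.

Definition commutec c d := mulc c d = mulc d c.

Lemma commutecP c d : commutec c d <-> forall i, commute (c i : gT) (d i).
Proof.
split=> [E i|E]; first exact: (congr1 (fun c : config gT => c i) E).
by apply/funext => i; exact: E.
Qed.

(** Endomorphisms preserve commutation, and commutation with one-site configurations tests single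
    values; the dynamical arguments rest on this. *)
Lemma commutec_delta c k g : commutec c (delta k g) <-> commute (c k : gT) g.
Proof.
split=> [/commutecP/(_ k)|E]; first by rewrite /delta eqxx.
apply/commutecP => i; rewrite /delta; case: eqP => [->//|_].
exact: commute1.
Qed.

Lemma mulc_delta k g h : mulc (delta k g) (delta k h) = delta k (g * h)%g.
Proof.
by apply/funext => i; rewrite /mulc /delta; case: eqP; rewrite ?mulg1.
Qed.

Lemma delta1 k : delta k 1%g = onec.
Proof. by apply/funext => i; rewrite /delta; case: eqP. Qed.

Lemma delta_inj k : injective (@delta gT k).
Proof. by move=> g h /(congr1 (fun c : config gT => c k)); rewrite /delta eqxx. Qed.

Lemma shiftz_delta n k g : shiftz n (delta k g) = delta (k - n)%R g.
Proof.
apply/funext => i; rewrite /shiftz /delta.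
by have -> : (i + n == k)%R = (i == k - n)%R by apply/eqP/eqP; lia.
Qed.

Lemma shiftzD n p c : shiftz n (shiftz p c) = shiftz (n + p)%R c.
Proof. by apply/funext => i; rewrite /shiftz addrA. Qed.

Lemma shiftz0 c : shiftz 0%R c = c.
Proof. by apply/funext => i; rewrite /shiftz addr0. Qed.

Section Endomorphism.
Variable F : config gT -> config gT.
Hypothesis FM : {morph F : c d / mulc c d}.
Hypothesis FS : forall c, F (shiftc c) = shiftc (F c).

Lemma endo1 : F onec = onec.
Proof.
have /(congr1 (fun c : config gT => c _)) E : mulc (F onec) (F onec) = F onec.
  by rewrite -FM; congr F; apply/funext => i; rewrite /mulc mulg1.
by apply/funext => i; apply: (mulgI (F onec i : gT)); rewrite [LHS]E mulg1.
Qed.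

Lemma endo_commutec c d : commutec c d -> commutec (F c) (F d).
Proof. by rewrite /commutec -!FM => ->. Qed.

Lemma endo_shiftz n c : F (shiftz n c) = shiftz n (F c).
Proof.
have nat_case (p : nat) e : F (shiftz p%:Z e) = shiftz p%:Z (F e).
  elim: p e => [|p IH] e; first by rewrite !shiftz0.
  have shiftzS e' : shiftz p.+1 e' = shiftz p (shiftc e').
    by apply/funext => i; rewrite /shiftz /shiftc; congr e'; lia.
  by rewrite !shiftzS IH FS.
case: n => p; first exact: nat_case.
(* For a negative shift, [c] is written as the shift by [p.+1] of its shift by [- p.+1], and the
   natural case applies. *)
rewrite NegzE -[RHS]/(shiftz (- p.+1%:Z)%R _) -{2}(shiftz0 c) -(subrr p.+1%:Z%R).
by rewrite -shiftzD nat_case shiftzD addNr shiftz0.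
Qed.

Lemma iter_mulc n : {morph iter n F : c d / mulc c d}.
Proof. by move=> c d; elim: n => //= n ->. Qed.

Lemma iter_shiftc n c : iter n F (shiftc c) = shiftc (iter n F c).
Proof. by elim: n => //= n ->. Qed.

End Endomorphism.
End ConfigGroup.

Section FactorPermutation.
Local Open Scope group_scope.
Variables (gT : finGroupType) (m : nat) (S : 'I_m -> {group gT}).
Hypothesis defG : \big[dprod/1]_(i < m) (S i : {set gT}) = [set: gT]%SET.
Hypothesis simS : forall i, simple (S i).
Hypothesis nabS : forall i, ~~ abelian (S i).
Hypothesis isoS : forall i j, S i \isog S j.
Variable F : config gT -> config gT.
Hypothesis FM : {morph F : c d / mulc c d}.
Hypothesis FS : forall c, F (shiftc c) = shiftc (F c).
Hypothesis Finj : injective F.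
Implicit Types (k l : int) (i j : 'I_m) (c d : config gT).

(** Lying outside ['C(S j)] means having a nontrivial component in [S j]: the image of the factor
    [(i, k)] projects nontrivially to the factor [(j, l)]. *)
Definition sees i k j l :=
  exists2 x, x \in S i & (F (delta k x) l : gT) \notin 'C(S j).

(* [F d] at [l] commutes with the image of the factor [(i, k)], which covers
   [S j] modulo ['C(S j)]; the center of [S j] is trivial. *)
Lemma sees_cent i k j l d :
  sees i k j l -> (d k : gT) \in 'C(S i) -> (F d l : gT) \in 'C(S j).
Proof.
case=> x0 x0S x0C dC.
pose phi x : gT := F (delta k x) l.
have phiM : {in S i &, {morph phi : x y / x * y}}.
  by move=> x y _ _; rewrite /phi -mulc_delta FM.
have onto := morph_factor_onto defG simS nabS isoS phiM x0S x0C.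
have cphi x : x \in S i -> commute (F d l : gT) (phi x).
  move=> xS; have /(endo_commutec FM)/commutecP/(_ l)// : commutec d (delta k x).
  by apply/commutec_delta; apply: (centP dC).
have [u uS] := factor_component defG j (F d l).
rewrite -[X in _ -> X \in _](mulKVg u); move: (u^-1 * _) (mulKVg u (F d l)) => z.
move=> Fdl zC; rewrite (_ : u = 1) ?mul1g//.
apply: (factor_cent_eq1 simS nabS uS); apply/centP => y yS.
have [x xS] := onto y yS; move: (y^-1 * _) (mulKVg y (phi x)) => z' phix zC'.
have := cphi x xS; rewrite -Fdl -phix /commute.
(* Up to elements of ['C(S j)], [u * y] and [y * u] agree; their quotient then lies in both [S j]
   and ['C(S j)], so it is 1. *)
move=> E; have {}E : u * y * (z * z') = y * u * (z' * z).
  transitivity (u * z * (y * z')).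
    by rewrite -!mulgA; congr (_ * _); rewrite !mulgA ((centP zC) y yS).
  rewrite E -!mulgA; congr (_ * _); rewrite !mulgA; congr (_ * _).
  exact: (centP zC').
have {}E : (y * u)^-1 * (u * y) = (z' * z) * (z * z')^-1.
  by apply: (canRL (mulgK _)); rewrite -mulgA E mulKg.
have : (y * u)^-1 * (u * y) = 1.
  apply: (factor_cent_eq1 simS nabS (i := j)).
    by rewrite groupM ?groupV ?groupM.
  by rewrite E groupM ?groupV ?groupM.
by move=> {}E; rewrite /commute -(mulKVg (y * u) (u * y)) E mulg1.
Qed.

Lemma sees_shiftz n i k j l : sees i k j l -> sees i (k + n)%R j (l + n)%R.
Proof.
case=> x xS xC; exists x => //.
have -> : delta (k + n)%R x = shiftz (- n)%R (delta k x).
  by rewrite shiftz_delta opprK.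
by rewrite (endo_shiftz FS) /shiftz addrK.
Qed.

Lemma delta_cent i i' k k' x : x \in S i' -> (i', k') != (i, k) ->
  (delta k' x k : gT) \in 'C(S i).
Proof.
move=> xS ne; rewrite /delta; case: eqP => [kk'|_]; last exact: group1.
by move: ne; rewrite kk' xpair_eqE eqxx andbT => /(factors_commute defG); apply.
Qed.

(** A factor other than [(i, k)] centralizes [(i, k)], so by [sees_cent] its image has no component
    in [(j, l)]. *)
Lemma sees_inj i k i' k' j l :
  sees i k j l -> sees i' k' j l -> (i', k') = (i, k).
Proof.
move=> s [x xS xC]; apply/eqP; apply: contraNT xC => ne.
exact: (sees_cent s (delta_cent xS ne)).
Qed.

Lemma not_cent_factor (x : gT) : x != 1 -> exists i, x \notin 'C(S i).
Proof.
move=> x1; apply/existsP; apply: contraNT x1; rewrite negb_exists => /forallP xC.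
by apply/eqP/(all_cent_eq1 defG simS nabS) => i; have := xC i; rewrite negbK.
Qed.

Lemma sees_total i : exists jl, sees i 0%R jl.1 jl.2.
Proof.
have [x xS x1] : exists2 x, x \in S i & x != 1.
  by apply/trivgPn; have [/negP] := simpleP _ (simS i); case: eqP.
suff [l Fx] : exists l, (F (delta 0 x) l : gT) != 1.
  by have [j Fxj] := not_cent_factor Fx; exists (j, l); exists x.
apply: contrapT => noF; case/eqP: x1; apply: (@delta_inj _ 0%R); apply: Finj.
rewrite delta1 (endo1 FM); apply/funext => l; apply: contrapT => Fx.
by apply: noF; exists l; apply/eqP.
Qed.

Definition simple_elt (g : gT) := g != 1 /\ exists i, g \in S i.

Definition maps_delta (H : config gT -> config gT) :=
  forall k g, simple_elt g ->
    exists k' g', simple_elt g' /\ H (delta k g) = delta k' g'.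

(** The factor [(i, k)] is sent onto [(tau i, k + n i)], and [tau] is a permutation. Surjectivity of
    [F] follows factor by factor and provides the inverse. *)
Lemma factor_automaton_bij : exists2 H, cancel H F & maps_delta F.
Proof.
have [t tP] := choice sees_total.
pose tau i := (t i).1; pose n i := (t i).2.
have see i k : sees i k (tau i) (k + n i)%R.
  by have := sees_shiftz k (tP i); rewrite add0r addrC.
(* If [tau i = tau i'], a shift makes both images hit the same site, and [sees_inj] applies. *)
have tau_inj : injective tau.
  move=> i i' E; have := see i 0%R; rewrite E.
  by have := see i' (n i - n i')%R; rewrite subrK add0r => /sees_inj H /H[].
have [tau' tauK tau'K] := injF_bij tau_inj.
have F_delta i k x : x \in S i ->
    exists2 y, y \in S (tau i) & F (delta k x) = delta (k + n i)%R y.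
  move=> xS.
  (* Any other factor [(j, l)] is reached from a source other than [(i, k)], where [delta k x] has
     no component. *)
  have Fcent j l : (j, l) != (tau i, k + n i)%R ->
      (F (delta k x) l : gT) \in 'C(S j).
    move=> ne; apply: (@sees_cent (tau' j) (l - n (tau' j))%R).
      by have := see (tau' j) (l - n (tau' j))%R; rewrite tau'K subrK.
    apply: (delta_cent xS); apply: contra ne => /eqP[-> ->].
    by rewrite tau'K subrK.
  have [y yS] := factor_component defG (tau i) (F (delta k x) (k + n i)%R).
  set z := y^-1 * _ => zC; exists y => //; apply/funext => l.
  rewrite /delta; case: eqP => [->|/eqP ne]; last first.
    apply: (all_cent_eq1 defG simS nabS) => j; apply: Fcent.
    by rewrite xpair_eqE (negPf ne) andbF.
  have : z = 1.
    apply: (all_cent_eq1 defG simS nabS) => j.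
    have [->//|ne] := eqVneq j (tau i); rewrite groupM ?groupV//.
      by apply: (factors_commute defG _ yS); rewrite eq_sym.
    by apply: Fcent; rewrite xpair_eqE (negPf ne).
  by move=> z1; rewrite -[LHS](mulKVg y) -/z z1 mulg1.
have F_delta_onto i k y : y \in S (tau i) ->
    exists2 x, x \in S i & F (delta k x) = delta (k + n i)%R y.
  move=> yS; have [x0 x0S x0C] := see i k.
  pose phi x : gT := F (delta k x) (k + n i)%R.
  have phiM : {in S i &, {morph phi : x y / x * y}}.
    by move=> x y' _ _; rewrite /phi -mulc_delta FM.
  have [x xS] := morph_factor_onto defG simS nabS isoS phiM x0S x0C yS.
  have [y' y'S E] := F_delta i k x xS; rewrite /phi E /delta eqxx => yy'.
  exists x => //; rewrite E; congr delta; apply: (mulgI y^-1); rewrite mulVg.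
  by apply: (factor_cent_eq1 simS nabS _ yy'); rewrite groupM ?groupV.
(* The components [u] of [d] are lifted to [x] through [F], and the lifts are glued at each site
   into [c]. *)
have F_onto d : exists c, F c = d.
  have /choice[u uP] : forall ik : 'I_m * int, exists u, u \in S (tau ik.1) /\
      u^-1 * d (ik.2 + n ik.1)%R \in 'C(S (tau ik.1)).
    move=> ik.
    have [u] := factor_component defG (tau ik.1) (d (ik.2 + n ik.1)%R).
    by exists u.
  have /choice[x xP] : forall ik : 'I_m * int, exists x, x \in S ik.1 /\
      F (delta ik.2 x) = delta (ik.2 + n ik.1)%R (u ik).
    by move=> ik; have [x] := F_delta_onto ik.1 ik.2 _ (uP ik).1; exists x.
  have /choice[c cP] : forall k, exists y, forall i, (x (i, k))^-1 * y \in 'C(S i).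
    by move=> k; apply: (glue_components defG) => i; have [] := xP (i, k).
  exists c; apply/funext => l; apply/esym/eqP; rewrite eq_mulVg1; apply/eqP.
  apply: (all_cent_eq1 defG simS nabS) => j.
  pose i := tau' j; pose k := (l - n i)%R.
  have jE : tau i = j by rewrite tau'K.
  have lE : (k + n i)%R = l by rewrite subrK.
  (* [c'] is [c] stripped of its component in [S i] at site [k], the only one that reaches
     [(j, l)]. *)
  pose c' := mulc (delta k (x (i, k))^-1) c.
  have cE : c = mulc (delta k (x (i, k))) c'.
    apply/funext => q; rewrite /c' /mulc mulgA /delta.
    by case: eqP => _; rewrite ?mulgV ?mulg1 mul1g.
  have c'C : (F c' l : gT) \in 'C(S j).
    apply: (@sees_cent i k); first by rewrite -jE -lE; exact: see.
    by rewrite /c' /mulc /delta eqxx; exact: cP.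
  have [_ uC] := uP (i, k); have [_ xE] := xP (i, k).
  rewrite cE FM xE /mulc /delta /= lE eqxx mulgA groupM//.
  by rewrite -groupV invMg invgK -lE -jE.
have [H HF] := choice F_onto; exists H => // k g [g1 [i gS]].
have [y yS E] := F_delta i k g gS.
exists (k + n i)%R, y; split=> //; split; last by exists (tau i).
apply: contra_neq g1 => y1; apply: (@delta_inj _ k); apply: Finj.
by rewrite E y1 !delta1 (endo1 FM).
Qed.

Lemma simple_elt_detect (x : gT) : x <> 1 -> exists2 g, simple_elt g & ~ commute x g.
Proof.
move=> /eqP/not_cent_factor[i xC]; apply: contrapT => noC.
case/negP: xC; apply/centP => g gS; apply: contrapT => xg; apply: noC.
exists g => //; split; last by exists i.
by apply/eqP => g1; apply: xg; rewrite g1; exact: commute1.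
Qed.

End FactorPermutation.

(** * Dynamics *)

Lemma iter_can (T : Type) (f g : T -> T) n :
  cancel f g -> cancel (iter n f) (iter n g).
Proof. by move=> fK; elim: n => // n IH x; rewrite iterSr /= fK IH. Qed.

Section Automorphism.
Variables (gT : finGroupType) (F H : config gT -> config gT).
Hypothesis FM : {morph F : c d / mulc c d}.
Hypothesis FS : forall c, F (shiftc c) = shiftc (F c).
Hypotheses (FK : cancel F H) (HK : cancel H F).
Implicit Types (c d : config gT) (g : gT) (k l : int).

Let HM : {morph H : c d / mulc c d}.
Proof. by move=> c d; apply: (can_inj FK); rewrite FM !HK. Qed.

Let HS c : H (shiftc c) = shiftc (H c).
Proof. by apply: (can_inj FK); rewrite FS !HK. Qed.

Lemma pinv_inverse : 'pinv_id setT F = H.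
Proof.
apply/funext => c; rewrite -{1}(HK c) pinvKV ?inE//.
by move=> x y _ _; exact: (can_inj FK).
Qed.

Lemma iterz_ind (Q : (config gT -> config gT) -> Prop) :
  (forall n, Q (iter n F)) -> (forall n, Q (iter n H)) -> forall n, Q (iterz F n).
Proof.
by move=> QF QH [n|n]; rewrite /iterz ?pinv_inverse; [exact: QF|exact: QH].
Qed.

Lemma iterz_mulc n : {morph iterz F n : c d / mulc c d}.
Proof.
move: n; apply: (iterz_ind (Q := fun G => {morph G : c d / mulc c d})) => n.
  exact: iter_mulc.
exact: iter_mulc.
Qed.

Lemma iterz_inj n : injective (iterz F n).
Proof.
move: n; apply: (iterz_ind (Q := fun G => injective G)) => n.
  exact: can_inj (iter_can n FK).
exact: can_inj (iter_can n HK).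
Qed.

Lemma iterz_periodic p c n : 0 < p -> iter p F c = c ->
  exists2 t, t < p & iterz F n c = iter t F c.
Proof.
move=> p0 cp; have cpq q : iter (q * p) F c = c.
  by elim: q => // q IH; rewrite mulSn iterD IH.
have modp r : iter r F c = iter (r %% p) F c.
  by rewrite {1}(divn_eq r p) addnC iterD cpq.
case: n => n; first by exists (n %% p); rewrite ?ltn_mod//= modp.
(* A natural number congruent to [- n.+1] modulo the period replaces the negative time. *)
exists ((n.+1 * p - n.+1) %% p); first by rewrite ltn_mod.
rewrite -modp /iterz pinv_inverse -{1}(cpq n.+1).
by rewrite -{1}(@subnKC n.+1 (n.+1 * p)) ?leq_pmulr// iterD (iter_can _ FK).
Qed.

Lemma iter_delta_shift n k l g :
  iter n F (delta 0%R g) = delta l g -> iter n F (delta k g) = delta (k + l)%R g.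
Proof.
move=> E; have -> : delta k g = shiftz (- k)%R (delta 0%R g).
  by rewrite shiftz_delta opprK add0r.
by rewrite (endo_shiftz (iter_shiftc FS n)) E shiftz_delta opprK addrC.
Qed.

(** * Periodic one-site configurations exclude both properties *)

Section Periodic.
Local Open Scope classical_set_scope.
Hypothesis Fcont : continuous F.

Lemma open_iterates n (A : set (config gT)) : open A ->
  open [set c | forall t, t < n -> A (iter t F c)].
Proof.
move=> oA; elim: n => [|n IH].
  rewrite (_ : [set _ | _] = setT); first exact: openT.
  by apply/seteqP; split.
rewrite (_ : [set c | forall t, t < n.+1 -> A (iter t F c)] =
   [set c | forall t, t < n -> A (iter t F c)] `&` (iter n F @^-1` A)).
  apply: openI => //; apply: open_comp => // c _.
  elim: n {IH} c => [|n IH] c; first exact: cvg_id.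
  exact: (@continuous_comp _ _ _ (iter n F) F c (IH c) (@Fcont _)).
apply/seteqP; split=> c /= cA; first by split=> [t tn|]; apply: cA; lia.
by move=> t; rewrite ltnS leq_eqVlt => /predU1P[->|]; apply cA.
Qed.

(** Let [U] require commutation with [g] at site 0 during one period. Applying [F] to both sides of
    commutation with the periodic [delta 0 g] extends this to all times, so orbits from [U] never
    meet [V]. *)
Lemma periodic_not_transitive :
  (forall x : gT, (forall y, commute x y) -> x = 1%g) ->
  has_periodic_delta F -> ~ transitive_gca F.
Proof.
move=> Z1 [g [p [g1 /andP[p0 _] gp]]] Ftr.
pose U := [set c | forall t, t < p -> commute (iter t F c 0%R : gT) g].
pose V := [set c : config gT | ~ commute (c 0%R : gT) g].
have oU : open U.
  exact: (open_iterates p (open_site 0%R [set x : gT | commute x g])).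
have oV : open V by exact: (open_site 0%R [set x : gT | ~ commute x g]).
have [y yg] : exists y, ~ commute y g.
  apply: contrapT => noy; case/eqP: g1; apply: Z1 => y; apply: contrapT => yg.
  by apply: noy; exists y => /esym.
have U0 : U !=set0.
  exists (onec gT) => t _; rewrite (endo1 (iter_mulc FM t)); exact/esym/commute1.
have [|n [_ [[c Uc <-]]]] := Ftr U V oU U0 oV.
  by exists (delta 0%R y); rewrite /V /= /delta eqxx.
apply; apply/commutec_delta.
have gpq q : iter (q * p) F (delta 0%R g) = delta 0%R g.
  by elim: q => // q IH; rewrite mulSn iterD IH.
rewrite (divn_eq n p) iterD -(gpq (n %/ p)).
apply: (endo_commutec (iter_mulc FM _)); apply/commutec_delta.
by apply: Uc; rewrite ltn_mod.
Qed.

Lemma open_cylinder (u : config gT) w : open (cylinder u w).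
Proof.
elim: w => [|w IH].
  rewrite (_ : cylinder u 0 = [set c | [set u 0%R] (c 0%R)]); first exact: open_site.
  by apply/seteqP; split=> c /= => [->//|c0 i]; rewrite leqn0 absz_eq0 => /eqP ->.
rewrite (_ : cylinder u w.+1 = cylinder u w
   `&` [set c | [set u w.+1%:Z%R] (c w.+1%:Z%R)]
   `&` [set c | [set u (- w.+1%:Z)%R] (c (- w.+1%:Z)%R)]).
  by do 2 (apply: openI; last exact: open_site).
apply/seteqP; split=> c /= => [cu|[[cu cw] cw'] i].
  by split; [split=> [i iw|]|]; apply: cu; lia.
rewrite leq_eqVlt => /predU1P[iw|]; last exact: cu.
by have [->|->] : (i = w.+1%:Z%R \/ i = - w.+1%:Z)%R by lia.
Qed.

(** By continuity at the identity, a translate of [delta 0 g] placed far enough away stays trivial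
    near the origin for one period, hence for all integer times, and is never separated from the
    identity. *)
Lemma periodic_not_expansive (R : realType) :
  has_periodic_delta F -> ~ expansive R F.
Proof.
move=> [g [p [g1 /andP[p0 _] gp]]] [e e0 Fexp].
have [w we] : exists w, (2^-1 ^+ w <= e :> R)%R.
  have [w _ /(_ w (leqnn w))/= we] := near_infty_natSinv_expn_lt (PosNum e0).
  by exists w; apply: ltW; rewrite exprVn -div1r.
pose U := [set c | forall t, t < p -> cylinder (onec gT) w (iter t F c)].
have [|v vU] := @nbhs_cylinder _ (onec gT) U (open_iterates _ (open_cylinder _ w)).
  by move=> t _; rewrite (endo1 (iter_mulc FM t)).
have Uc : U (delta v.+1%:Z%R g).
  by apply: vU => i iv; rewrite /delta; case: eqP => // E; lia.
have [|n] := Fexp (delta v.+1%:Z%R g) (onec gT).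
  move=> /(congr1 (fun c : config gT => c v.+1%:Z%R)); rewrite /delta eqxx.
  by move/eqP; rewrite (negPf g1).
have [|t tp ->] := @iterz_periodic p (delta v.+1%:Z%R g) n p0.
  by rewrite (iter_delta_shift _ gp) addr0.
rewrite (endo1 (iterz_mulc n)); apply/negP; rewrite -leNgt.
by apply: (le_trans (dist_le _ _) we) => i iw; apply: (Uc _ tp); exact: ltnW.
Qed.

End Periodic.

(** * Aperiodic one-site configurations drift, which gives both properties *)

Section Aperiodic.
(** [P] stands for [simple_elt]: its one-site configurations are permuted among themselves and
    detect nontrivial values. *)
Variable P : gT -> Prop.
Hypothesis P_neq1 : forall g, P g -> g != 1%g.
Hypothesis P_detect : forall x : gT, x <> 1%g -> exists2 g, P g & ~ commute x g.
Hypothesis F_delta : forall k g, P g ->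
  exists k' g', P g' /\ F (delta k g) = delta k' g'.
Hypothesis aperiodic : ~ has_periodic_delta F.

(** Among the values at times 0 to [#|gT|] two coincide, at times [a < b]; cancelling [F ^ a] brings
    the value back to [g] itself at time [b - a]. *)
Lemma delta_recurrent g : P g ->
  exists n l, 0 < n <= #|gT| /\ iter n F (delta 0%R g) = delta l g.
Proof.
move=> Pg.
have /choice[kg kgP] : forall t, exists kg : int * gT,
    P kg.2 /\ iter t F (delta 0%R g) = delta kg.1 kg.2.
  elim=> [|t [[k h] /= [Ph E]]]; first by exists (0%R, g).
  by have [k' [h' [Ph' E']]] := F_delta k Ph; exists (k', h'); rewrite E.
have : ~~ injectiveb (fun t : 'I_#|gT|.+1 => (kg t).2).
  by apply/injectiveP => /leq_card; rewrite card_ord ltnn.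
case/injectivePn => a [b ab E].
wlog {ab} ab : a b E / a < b.
  move=> wl; have [lt|lt|/val_inj eq] := ltngtP a b.
  - exact: (wl a b).
  - exact: (wl b a).
  - by rewrite eq eqxx in ab.
exists (b - a), ((kg b).1 - (kg a).1)%R; split.
  by have := ltn_ord b; lia.
apply: (can_inj (iter_can a FK)).
rewrite -iterD subnKC ?(ltnW ab)// (kgP b).2 -E.
have -> : delta ((kg b).1 - (kg a).1)%R g =
    shiftz ((kg a).1 - (kg b).1)%R (delta 0%R g).
  by rewrite shiftz_delta add0r opprB.
rewrite (endo_shiftz (iter_shiftc FS a)) (kgP a).2 shiftz_delta.
by congr delta; lia.
Qed.

(** The factorial is a multiple of every return time, so one exponent serves all [g]. *)
Lemma delta_drift g : P g -> exists2 D, D != 0%R &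
  forall k, iter (#|gT| `!) F (delta k g) = delta (k + D)%R g.
Proof.
move=> Pg; have [n [l [nG E]]] := delta_recurrent Pg.
have l0 : l != 0%R.
  by apply/eqP => l0; apply: aperiodic; exists g, n; rewrite P_neq1// E l0.
have /dvdnP[q qE] : n %| #|gT| `! by exact: dvdn_fact.
exists (l * q%:Z)%R.
  rewrite mulf_neq0//; apply: contraTneq (fact_gt0 #|gT|) => q0.
  by rewrite qE; case: q q0 {qE}.
rewrite {}qE; elim: q => [|q IH] k; first by rewrite mulr0 addr0.
rewrite mulSn iterD IH (iter_delta_shift _ E); congr delta; lia.
Qed.

Local Notation N := (#|gT| `!).

Lemma delta_drift_iter g D : 
    (forall k, iter N F (delta k g) = delta (k + D)%R g) ->
  forall t k, iter (N * t) F (delta k g) = delta (k + D * t%:Z)%R g.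
Proof.
move=> DE; elim=> [|t IH] k; first by rewrite muln0 mulr0 addr0.
by rewrite mulnS iterD IH DE; congr delta; lia.
Qed.

Lemma delta_drift_iter_inv g D : 
    (forall k, iter N F (delta k g) = delta (k + D)%R g) ->
  forall t k, iter (N * t) H (delta k g) = delta (k - D * t%:Z)%R g.
Proof.
move=> DE t k; apply: (can_inj (iter_can (N * t) FK)).
by rewrite (iter_can _ HK) (delta_drift_iter DE) subrK.
Qed.

(** A difference at site [k] is detected by some [delta k g], which drifts by multiples of [D g] to
    the residue of [k] modulo [D g]. The difference thus becomes visible at a site below [K] in
    absolute value. *)
Lemma aperiodic_expansive (R : realType) : expansive R F.
Proof.
have /choice[D DP] : forall g, exists D, P g -> D != 0%R /\
    forall k, iter N F (delta k g) = delta (k + D)%R g.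
  move=> g; have [Pg|] := pselect (P g); last by exists 0%R.
  by have [D] := delta_drift Pg; exists D.
pose K := \max_(g : gT) `|D g|%N.
exists (2^-1 ^+ K)%R; first by rewrite exprn_gt0// invr_gt0.
move=> c d cd; have [k ck] : exists k, c k <> d k.
  apply: contrapT => nok; apply: cd; apply/funext => k; apply: contrapT => ck.
  by apply: nok; exists k.
have [e de] : exists e : config gT, d = mulc c e.
  exists (fun i => (c i : gT)^-1 * d i)%g.
  by apply/funext => i; rewrite /mulc mulKVg.
have [|g Pg ekg] := @P_detect (e k).
  by move=> ek1; apply: ck; rewrite de /mulc ek1 mulg1.
have [D0 DE] := DP g Pg.
have [n nE] : exists n, iterz F n (delta k g) = delta (k %% D g)%Z g.
  have kE : (k - D g * (k %/ D g)%Z = (k %% D g)%Z)%R.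
    by rewrite {1}(divz_eq k (D g)) mulrC addrC addKr.
  (* The time is [- N] times the quotient; its sign decides between [F] and its inverse. *)
  case: (k %/ D g)%Z kE => q kE.
    exists (- (N * q)%N%:Z)%R.
    case E : (N * q) => [|r].
      move: kE; move/eqP: E; rewrite muln_eq0 -leqn0 leqNgt fact_gt0 /= => /eqP ->.
      by rewrite mulr0 subr0 => <-.
    by rewrite -NegzE /= pinv_inverse -iterS -E (delta_drift_iter_inv DE) kE.
  exists (N * q.+1)%N%:Z%R; rewrite /= (delta_drift_iter DE); congr delta.
  by rewrite -kE NegzE; lia.
exists n; set k' := (k %% D g)%Z in nE.
(* Otherwise the image of [e] is trivial at [k'] and commutes with the image of [delta k g]; pulling
   back, [e k] commutes with [g]. *)
have ck' : iterz F n c k' <> iterz F n d k'.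
  move=> E; apply: ekg; apply/commutec_delta; apply: (@iterz_inj n).
  rewrite !iterz_mulc nE; apply/commutec_delta.
  suff -> : (iterz F n e k' : gT) = 1%g by exact/commute_sym/commute1.
  apply: (mulgI (iterz F n c k' : gT)); rewrite mulg1 [RHS]E.
  by rewrite de iterz_mulc.
apply: (lt_le_trans _ (dist_ge R ck')).
rewrite ltr_iXn2l ?invr_gt0 ?invf_lt1 ?ltr0n ?ltr1n//.
apply: (@leq_trans `|D g|%N); last exact: (leq_bigmax g).
by have := ltz_mod k D0; have := modz_ge0 k D0; rewrite -/k'; lia.
Qed.

(** A nontrivial value at [l] would fail to commute with some [delta l g], the image of a
    [delta k g] that commutes with [e]. *)
Lemma endo_vanish (G : config gT -> config gT) (e : config gT) l :
    {morph G : c d / mulc c d} ->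
    (forall g, P g -> exists2 k, G (delta k g) = delta l g & e k = 1%g) ->
  G e l = 1%g.
Proof.
move=> GM Ge; apply: contrapT => /P_detect[g Pg]; apply.
apply/commutec_delta; have [k <- ek] := Ge g Pg.
apply: (endo_commutec GM); apply/commutec_delta; rewrite ek.
exact/commute_sym/commute1.
Qed.

(** The point [c] multiplies the window of [u] by the preimage under [F ^ n] of the window of [v].
    For this [n] each piece is trivial on the window where the other one counts. *)
Lemma aperiodic_transitive : transitive_gca F.
Proof.
move=> U V oU [u Uu] oV [v Vv].
have [w1 uU] := nbhs_cylinder oU Uu; have [w2 vV] := nbhs_cylinder oV Vv.
(* Time [n] moves every one-site configuration by at least [2 * w + 1], more than the diameter of
   the window. *)
pose w := maxn w1 w2; pose n := N * (2 * w + 1).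
pose window (x : config gT) : config gT := fun i => if `|i|%N <= w then x i else 1%g.
have window_out x i : w < `|i|%N -> window x i = 1%g.
  by rewrite /window ltnNge => /negPf ->.
have n_out g l : P g -> `|l|%N <= w ->
    (exists2 k, iter n F (delta l g) = delta k g & w < `|k|%N) /\
    (exists2 k, iter n H (delta l g) = delta k g & w < `|k|%N).
  move=> Pg lw; have [D D0 DE] := delta_drift Pg.
  split.
    by exists (l + D * (2 * w + 1)%N%:Z)%R; [exact: delta_drift_iter DE _ _|nia].
  exists (l - D * (2 * w + 1)%N%:Z)%R; [exact: delta_drift_iter_inv DE _ _|nia].
have FnK := iter_can n FK; have HnK := iter_can n HK.
pose c := mulc (window u) (iter n H (window v)).
exists n, (iter n F c); split.
  exists c => //; apply: uU => i iw; rewrite /c /mulc.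
  rewrite (@endo_vanish (iter n H)) ?mulg1.
  - by rewrite /window ifT//; lia.
  - exact: iter_mulc.
  move=> g Pg; have [|[k E kw] _] := n_out g i Pg; first lia.
  by exists k; [rewrite -E FnK|exact: window_out].
apply: vV => i iw; rewrite /c (iter_mulc FM) HnK /mulc.
rewrite (@endo_vanish (iter n F)) ?mul1g.
- by rewrite /window ifT//; lia.
- exact: iter_mulc.
move=> g Pg; have [|_ [k E kw]] := n_out g i Pg; first lia.
by exists k; [rewrite -E HnK|exact: window_out].
Qed.

End Aperiodic.
End Automorphism.

(** * Both properties are equivalent to aperiodicity *)

Section Dichotomy.
Variables (gT : finGroupType) (F : config gT -> config gT).
Hypothesis sG : prod_isog_simple gT.
Hypothesis Fgca : gca F.
Hypothesis Finj : injective F.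

Lemma transitive_aperiodic : transitive_gca F <-> ~ has_periodic_delta F.
Proof.
have [m [S [_ defG simS nabS isoS]]] := sG; have [Fcont FM FS] := Fgca.
split=> [Ftr per|aper].
  exact: periodic_not_transitive (center_trivial defG simS nabS) per Ftr.
have [H HK mapsF] := factor_automaton_bij defG simS nabS isoS FM FS Finj.
have FK := inj_can_sym HK Finj.
apply: (aperiodic_transitive FM FS FK HK _ _ mapsF aper) => [g []//|].
exact: simple_elt_detect defG simS nabS.
Qed.

Lemma expansive_aperiodic (R : realType) : expansive R F <-> ~ has_periodic_delta F.
Proof.
have [m [S [_ defG simS nabS isoS]]] := sG; have [Fcont FM FS] := Fgca.
have [H HK mapsF] := factor_automaton_bij defG simS nabS isoS FM FS Finj.
have FK := inj_can_sym HK Finj.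
split=> [Fexp per|aper].
  exact: (periodic_not_expansive FM FS FK HK Fcont per Fexp).
apply: (aperiodic_expansive FM FS FK HK _ _ mapsF aper) => [g []//|].
exact: simple_elt_detect defG simS nabS.
Qed.

End Dichotomy.

Theorem theorem5 (R : realType) :
  (forall (gT : finGroupType) (F : config gT -> config gT),
      prod_isog_simple gT -> gca F -> injective F ->
      (transitive_gca F <-> expansive R F)) /\
  decidable_for_injective_gca transitive_gca /\
  decidable_for_injective_gca (expansive R).
Proof.
split; last split.
- move=> gT F sG Fgca Finj.
  by rewrite (transitive_aperiodic sG Fgca Finj) (expansive_aperiodic sG Fgca Finj).
- exact: decidable_periodic_delta (@transitive_aperiodic).
- apply: decidable_periodic_delta => gT F sG Fgca Finj.
  exact: expansive_aperiodic.
Qed.
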